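(* There exist constants $C_1,C_2>0$ such that, for any positive integers $m\le n$, $$n^{-(m-1)}\le \pi(m,n)\le C_1\cdot n^{-C_2 m},$$ where $\pi(m,n)$ is the probability that the random game $G(m,n)$ is strict-dominance solvable. In particular, $\pi(n,n)\le n^{-\left(\frac13-o(1)\right)n}$, where $o(1)$ denotes a quantity tending to $0$ as $n\to\infty$.
   Context: Random game $G(m,n)$ ($m,n$ positive integers): there are two players, Row with action set $[m]=\{1,\dots,m\}$ and Column with action set $[n]=\{1,\dots,n\}$. Payoffs are given by $m\times n$ matrices $R=(r_{ij})$ (Row's payoffs) and $C=(c_{ij})$ (Column's payoffs). For each $j\in[n]$ the column $r_{\cdot j}=(r_{1j},\dots,r_{mj})$ is a uniformly random permutation of $[m]$; for each $i\in[m]$ the row $c_{i\cdot}=(c_{i1},\dots,c_{in})$ is a uniformly random permutation of $[n]$; all these $m+n$ random permutations are mutually independent. Dominance (by pure actions only): in a (sub)game with row set $Y\subseteq[m]$ and column set $X\subseteq[n]$, Row's action $i\in Y$ is strictly dominated if there is $i'\in Y$ with $r_{i'x}>r_{ix}$ for all $x\in X$; Column's action $j\in X$ is strictly dominated if there is $j'\in X$ with $c_{yj'}>c_{yj}$ for all $y\in Y$. Iterated elimination: in each round, both players simultaneously delete all their actions that are strictly dominated in the current subgame; the procedure stops when there are no strictly dominated actions. The game is strict-dominance solvable if exactly one action is left for each player at the end. $\pi(m,n)$ is the probability that $G(m,n)$ is strict-dominance solvable.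
   Formalization: The upper bound is stated only for m ≥ 2: for m = 1 one has π(1,n) = 1 for every n, so no constants C_1, C_2 > 0 can work; the lower bound and the bound on π(n,n) are kept for all positive integers. *)

(* Defs.v *)
From HB Require Import structures.
From mathcomp Require Import all_boot all_order all_algebra all_fingroup.
From mathcomp Require Import all_classical all_reals all_analysis.
Import Order.TTheory GRing.Theory Num.Theory.
Import numFieldNormedType.Exports.

Set Implicit Arguments.
Unset Strict Implicit.
Unset Printing Implicit Defensive.

Local Open Scope ring_scope.

(* A realization of the m + n random permutations: [g.1 j] is the column      *)
(* [r_{.j}] of Row's payoffs and [g.2 i] is the row [c_{i.}] of Column's      *)
(* payoffs.  Payoffs range over 0, ..., m-1 (resp. 0, ..., n-1) instead of    *)
(* 1, ..., m (resp. 1, ..., n); only their order matters.                     *)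
Definition game (m n : nat) : finType :=
  ({ffun 'I_n -> {perm 'I_m}} * {ffun 'I_m -> {perm 'I_n}})%type.

Definition row_payoff m n (g : game m n) (i : 'I_m) (j : 'I_n) : nat :=
  g.1 j i.

Definition col_payoff m n (g : game m n) (i : 'I_m) (j : 'I_n) : nat :=
  g.2 i j.

Definition subgame (m n : nat) : Type := ({set 'I_m} * {set 'I_n})%type.

Definition row_dominated m n (g : game m n) (S : subgame m n) (i : 'I_m) :=
  [exists i' in S.1, forall x in S.2,
     (row_payoff g i x < row_payoff g i' x)%N].

Definition col_dominated m n (g : game m n) (S : subgame m n) (j : 'I_n) :=
  [exists j' in S.2, forall y in S.1,
     (col_payoff g y j < col_payoff g y j')%N].

Definition elim_round m n (g : game m n) (S : subgame m n) : subgame m n :=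
  ([set i in S.1 | ~~ row_dominated g S i],
   [set j in S.2 | ~~ col_dominated g S j])%SET.

(* A round that is not idle deletes at least one of the m + n actions, so the *)
(* procedure has stopped after m + n rounds: see [surviving_stable].          *)
Definition surviving m n (g : game m n) : subgame m n :=
  iter (m + n) (elim_round g) ([set: 'I_m], [set: 'I_n])%SET.

Definition dominance_solvable m n (g : game m n) : bool :=
  (#|(surviving g).1| == 1%N) && (#|(surviving g).2| == 1%N).

(* The independent uniform permutations are the coordinates of a uniform      *)
(* point of the finite product space [game m n].                              *)
Definition solvability_prob (R : realType) (m n : nat) : R :=
  #|[set g : game m n | dominance_solvable g]%SET|%:R / #|game m n|%:R.

Lemma surviving_stable m n (g : game m n) :
  elim_round g (surviving g) = surviving g.
Proof.
pose T0 : subgame m n := ([set: 'I_m], [set: 'I_n])%SET.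
pose size_of (S : subgame m n) := (#|S.1| + #|S.2|)%N.
have sub1 (S : subgame m n) : (elim_round g S).1 \subset S.1.
  by apply/fintype.subsetP => i; rewrite inE => /andP[].
have sub2 (S : subgame m n) : (elim_round g S).2 \subset S.2.
  by apply/fintype.subsetP => j; rewrite inE => /andP[].
have drop (S : subgame m n) :
    elim_round g S = S \/ (size_of (elim_round g S) < size_of S)%N.
  have [|neq1] := eqVneq (elim_round g S).1 S.1; last first.
    right; rewrite /size_of -addSn leq_add ?subset_leq_card //.
    by apply: proper_card; rewrite finset.properEneq neq1 sub1.
  have [|neq2] := eqVneq (elim_round g S).2 S.2; last first.
    right; rewrite /size_of -addnS leq_add ?subset_leq_card //.
    by apply: proper_card; rewrite finset.properEneq neq2 sub2.
  move=> e2 e1; left.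
  by rewrite [LHS]surjective_pairing e1 e2 -surjective_pairing.
have main k : elim_round g (iter k (elim_round g) T0) = iter k (elim_round g) T0
    \/ (size_of (iter k (elim_round g) T0) + k <= m + n)%N.
  elim: k => [|k [IH|IH]]; first by right; rewrite addn0 /size_of !cardsT !card_ord.
    by left; rewrite /= !IH.
  case: (drop (iter k (elim_round g) T0)) => [E|lt]; first by left; rewrite /= !E.
  by right; rewrite iterS addnS; apply: leq_trans IH; rewrite -addSn leq_add2r.
have [//|le] := main (m + n)%N.
have z : size_of (surviving g) = 0%N.
  by apply/eqP; move: le; rewrite -/(surviving g) -{2}[(m + n)%N]add0n leq_add2r leqn0.
by case: (drop (surviving g)) => [//|]; rewrite z ltn0.
Qed.

(* Main.v *)
Require Import Defs.
From HB Require Import structures.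
From mathcomp Require Import all_boot all_order all_algebra all_fingroup.
From mathcomp Require Import zify ring lra.

Set Implicit Arguments.
Unset Strict Implicit.
Unset Printing Implicit Defensive.

Import Order.TTheory GRing.Theory Num.Theory.

(* Lower bound: with probability n * n^-m some column is the best reply to    *)
(* every row, and then the game is solvable.                                  *)
(*                                                                            *)
(* Upper bound for n < m^4: stop the elimination just after s rows or s       *)
(* columns are gone.  Say s columns are: each of them is dominated by a       *)
(* remaining one on a set of at least m - s rows.  A uniform permutation      *)
(* respects s given inequalities of this kind with probability at most        *)
(* 1/(1+s), and there are at most n^(3s) choices for the columns, their       *)
(* dominators and the s rows left out, so the probability is at most          *)
(* 2 n^(3s) (1+s)^-(m-s); take s = m/32.                                      *)
(*                                                                            *)
(* Upper bound for m^4 <= n: some row must be dominated on the set X of the   *)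
(* columns that are undominated in the full game.  X depends on Column's      *)
(* payoffs only, so the probability is at most m^2 E[2^-|X|].  Once the       *)
(* columns are ordered by the first row, X contains the records of each of    *)
(* the m - 1 other rows.  A uniform permutation has few records outside a     *)
(* given set of at most B columns: the expectation of 2^-(their number) is    *)
(* at most sqrt((B+1)/(n+1)).  Adding the rows one at a time bounds E[2^-|X|] *)
(* by 2^-B + ((B+1)/(n+1))^((m-1)/2).                                         *)

(** All realizations are equally likely, so every estimate is a count in [game m n]. The lower bound
    [card_solvable_ge] counts games with a dominant column. For the upper bound,
    [card_solvable_crushed] pays n^(3s) to name the early deletions and gains (1+s)^(m-s), which
    wins only if m is at least a power of n; [solvable_le_pareto] covers smaller m, where many
    undominated columns protect all rows. [solvability_prob_exprn] joins both into 2 n^(-m/256) for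
    large n. For m = n the first estimate alone gives exponent 86n/256 > n/3, so the error term
    vanishes for large n. *)

(** * Counting permutations *)

(* Exchanging the values at [d i] and [e i], for i < s, gives s pairwise      *)
(* disjoint copies of the set, also disjoint from the set itself: [d i] is    *)
(* recovered as the largest-valued [d k] whose inequality fails.              *)
Lemma card_perm_ordered_pairs N s (d e : 'I_s -> 'I_N) :
    injective d -> (forall i k, e i != d k) ->
  s.+1 * #|[set u : {perm 'I_N} | [forall i, u (d i) < u (e i)]]| <= N`!.
Proof.
move=> d_inj ed; set E := [set u | _].
pose swap (uo : {perm 'I_N} * option 'I_s) : {perm 'I_N} :=
  if uo.2 is Some i then (tperm (d i) (e i) * uo.1)%g else uo.1.
have swapL u i : swap (u, Some i) (d i) = u (e i) by rewrite permM tpermL.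
have swapR u i : swap (u, Some i) (e i) = u (d i) by rewrite permM tpermR.
have swapD u i k : k != i -> swap (u, Some i) (d k) = u (d k).
  by move=> ki; rewrite permM tpermD // eq_sym ?ed // (inj_eq d_inj).
have swapN u i k : e k != e i -> swap (u, Some i) (e k) = u (e k).
  by move=> ki; rewrite permM tpermD // eq_sym ?ed // eq_sym.
have inE' u i : u \in E -> u (d i) < u (e i).
  by rewrite inE => /forallP.
(* The [e k] may coincide, so the exchange can break an inequality k <> i; this forces [e k = e i],
   and then [d k] carries less than [u (e i)], the value now at [d i]. *)
have viol u i k : u \in E ->
    swap (u, Some i) (e k) < swap (u, Some i) (d k) ->
  swap (u, Some i) (d k) <= swap (u, Some i) (d i).
  move=> uE; have [->//|ki] := eqVneq k i; rewrite swapL swapD //.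
  have [eki _|eki] := eqVneq (e k) (e i).
    by rewrite ltnW // -eki inE'.
  by rewrite swapN // ltnNge ltnW // inE'.
have swap_inj : {in setX E [set: option 'I_s] &, injective swap}.
  move=> [u1 o1] [u2 o2]; rewrite !in_setX !in_setT !andbT /= => u1E u2E.
  case: o1 o2 => [i|] [k|] eqs.
  - have ik : i = k.
      apply: d_inj; apply: (@perm_inj _ (swap (u1, Some i))).
      apply/val_inj/eqP; rewrite eqn_leq {1}eqs [X in X <= _]/=.
      apply/andP; split.
        by rewrite eqs viol // -eqs swapL swapR inE'.
      by rewrite viol // eqs swapL swapR inE'.
    by move: eqs; rewrite ik /swap /= => /mulgI ->.
  - have := inE' u2 i u2E; rewrite -[u2]/(swap (u2, None)) -eqs swapL swapR.
    by rewrite ltnNge ltnW // inE'.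
  - have := inE' u1 k u1E; rewrite -[u1]/(swap (u1, None)) eqs swapL swapR.
    by rewrite ltnNge ltnW // inE'.
  - by rewrite -[u1]/(swap (u1, None)) eqs.
have := max_card (mem (swap @: setX E [set: option 'I_s])).
rewrite card_in_imset // cardsX cardsT card_option card_ord mulnC.
by rewrite card_Sn.
Qed.

Lemma card_ffun_in (T1 T2 : finType) (E : {set T2}) (Y : {set T1}) k :
    k * #|E| <= #|T2| ->
  k ^ #|Y| * #|[set p : {ffun T1 -> T2} | [forall y in Y, p y \in E]]|
    <= #|T2| ^ #|T1|.
Proof.
move=> kE; pose F y := mem (if y \in Y then E else [set: T2]).
have -> : #|[set p : {ffun T1 -> T2} | [forall y in Y, p y \in E]]|
    = \prod_y #|F y|.
  transitivity #|family F|; last by rewrite card_family foldrE big_image.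
  apply: eq_card => p; rewrite inE.
  apply/forall_inP/familyP => pE y.
    by rewrite /F; case: ifPn => [/pE//|_]; rewrite inE.
  by move=> yY; have := pE y; rewrite /F yY.
have -> : k ^ #|Y| = \prod_y (if y \in Y then k else 1).
  by rewrite -big_mkcond prod_nat_const.
rewrite -big_split -prod_nat_const; apply: leq_prod => y _.
by rewrite /= /F; case: ifP => _ //=; rewrite mul1n max_card.
Qed.

Lemma card_set_exists (I T : finType) (P : I -> pred T) :
  #|[set x | [exists i, P i x]]| <= \sum_i #|[set x | P i x]|.
Proof.
under eq_bigr do rewrite -sum1dep_card big_mkcond.
rewrite exchange_big -sum1dep_card big_mkcond leq_sum // => x _.
by case: ifP => // /existsP[i Pix]; rewrite (bigD1 i) //= Pix.
Qed.

Lemma lift_perm_inj2 n (i : 'I_n.+1) :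
  injective (fun ku : 'I_n.+1 * {perm 'I_n} => lift_perm i ku.1 ku.2).
Proof.
move=> [k u] [l v] /= eqp.
have kl : k = l by rewrite -(lift_perm_id i k u) eqp lift_perm_id.
rewrite -kl in eqp *; congr (_, _); apply/permP => x.
by apply: (@lift_inj _ k); rewrite -!(lift_perm_lift i) eqp.
Qed.

(** * Dominance *)

(** [T1] holds the opponent's actions and [T2] the player's own, so that one set of lemmas serves
    Row and Column. *)
Definition dominates (T1 T2 : finType) (v : T1 -> T2 -> nat) (Y : {set T1})
    (j j' : T2) :=
  [forall y in Y, v y j < v y j'].

Definition undominated (T1 T2 : finType) (v : T1 -> T2 -> nat) (Y : {set T1})
    (X : {set T2}) :=
  [set j in X | ~~ [exists j' in X, dominates v Y j j']].

(** The invariant of elimination: by transitivity, deleted dominators can be replaced by remaining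
    ones. *)
Definition covered (T1 T2 : finType) (v : T1 -> T2 -> nat) (Y : {set T1})
    (X : {set T2}) :=
  forall j, j \notin X -> exists2 j', j' \in X & dominates v Y j j'.

(* t = (d, e, h): the s actions [d i] are dominated by the actions [e i]      *)
(* outside the at most s opponent's actions [h i].  Counting such triples     *)
(* rather than sets keeps their number at most #|T2|^(2s) * #|T1|^s.          *)
Definition crushing (T1 T2 : finType) (v : T1 -> T2 -> nat) s
    (t : {ffun 'I_s -> T2} * {ffun 'I_s -> T2} * {ffun 'I_s -> T1}) :=
  [&& injectiveb t.1.1, [forall i, forall k, t.1.2 i != t.1.1 k]
    & [forall y in ~: [set t.2 i | i : 'I_s],
         forall i, v y (t.1.1 i) < v y (t.1.2 i)]].

Definition crushed (T1 T2 : finType) (v : T1 -> T2 -> nat) s :=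
  [exists t : {ffun 'I_s -> T2} * {ffun 'I_s -> T2} * {ffun 'I_s -> T1},
     crushing v t].

Lemma dominates_trans (T1 T2 : finType) (v : T1 -> T2 -> nat) Y :
  transitive (dominates v Y).
Proof.
move=> j2 j1 j3 /forall_inP d12 /forall_inP d23.
by apply/forall_inP => y yY; apply: ltn_trans (d12 y yY) (d23 y yY).
Qed.

Lemma dominates_sub (T1 T2 : finType) (v : T1 -> T2 -> nat) (Y Y' : {set T1})
  j j' : Y' \subset Y -> dominates v Y j j' -> dominates v Y' j j'.
Proof.
move=> /subsetP YY' /forall_inP d; apply/forall_inP => y yY'.
exact/d/YY'.
Qed.

(** Among the dominators of [j], one with the largest payoff at a fixed [y0] is undominated:
    whatever beat it would also dominate [j]. *)
Lemma undominated_dominator (T1 T2 : finType) (v : T1 -> T2 -> nat)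
    (Y : {set T1}) (X : {set T2}) j :
    Y != set0 -> j \in X -> j \notin undominated v Y X ->
  exists2 j', j' \in undominated v Y X & dominates v Y j j'.
Proof.
move=> /set0Pn[y0 y0Y] jX; rewrite inE jX /= negbK => /exists_inP[j0 j0X d0].
have P0 : (j0 \in X) && dominates v Y j j0 by rewrite j0X.
case: (@arg_maxnP _ j0 (fun k => (k \in X) && dominates v Y j k) (v y0) P0).
move=> j1 /andP[j1X d1] j1max; exists j1 => //; rewrite inE j1X /=.
apply/negP => /exists_inP[j2 j2X d2].
have := j1max j2; rewrite j2X (dominates_trans d1 d2) => /(_ isT).
by rewrite /= leqNgt (forall_inP d2 y0 y0Y).
Qed.

Lemma covered_undominated (T1 T2 : finType) (v : T1 -> T2 -> nat)
    (Y : {set T1}) (X : {set T2}) :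
  Y != set0 -> covered v Y X -> covered v Y (undominated v Y X).
Proof.
move=> Y0 cov j jN; have [jX|/cov[j1 j1X d1]] := boolP (j \in X).
  exact: undominated_dominator.
have [j1U|/(undominated_dominator Y0 j1X)[j2 j2U d2]] :=
  boolP (j1 \in undominated v Y X); first by exists j1.
by exists j2 => //; apply: dominates_trans d1 d2.
Qed.

Lemma covered_crushed (T1 T2 : finType) (v : T1 -> T2 -> nat)
    (Y : {set T1}) (X : {set T2}) s :
    0 < s -> Y != set0 -> #|T1| <= #|Y| + s -> #|X| + s <= #|T2| ->
  covered v Y X -> crushed v s.
Proof.
move=> s0 /set0Pn[y0 y0Y] Ys Xs cov.
have sX : s <= #|~: X| by move: (cardsC X); lia.
have /card_gt0P[j0 j0X] : 0 < #|~: X| by apply: leq_trans sX.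
pose d := [ffun i : 'I_s => nth j0 (enum (~: X)) i].
have dX i : d i \notin X.
  rewrite -in_setC -mem_enum ffunE mem_nth // -cardE.
  exact: leq_trans (ltn_ord i) sX.
have d_inj : injective d.
  move=> i k /eqP; rewrite !ffunE nth_uniq ?enum_uniq -?cardE //.
  - by move=> /eqP /val_inj.
  - exact: leq_trans (ltn_ord i) sX.
  - exact: leq_trans (ltn_ord k) sX.
pose e := [ffun i : 'I_s => odflt j0 [pick j in X | dominates v Y (d i) j]].
have eP i : e i \in X /\ dominates v Y (d i) (e i).
  rewrite [e i]ffunE; case: pickP => [j /andP[]//|/=].
  by have [j jX dj] := cov _ (dX i); move=> /(_ j); rewrite jX dj.
(* [h] lists the complement of [Y], padded with [y0]; leaving out [y0] as well only weakens the
   requirement. *)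
pose h := [ffun i : 'I_s => nth y0 (enum (~: Y)) i].
apply/existsP; exists (d, e, h); rewrite /crushing /=; apply/and3P; split.
- exact/injectiveP.
- apply/forallP => i; apply/forallP => k.
  by apply: contraNneq (dX k) => <-; have [] := eP i.
- apply/forall_inP => y; rewrite inE => yh; apply/forallP => i.
  have [_ /forall_inP dom] := eP i; apply: dom.
  apply: contraNT yh => yY.
  have yC : y \in enum (~: Y) by rewrite mem_enum inE.
  have ys : index y (enum (~: Y)) < s.
    have : index y (enum (~: Y)) < #|~: Y| by rewrite cardE index_mem.
    by move: (cardsC Y); lia.
  by apply/imsetP; exists (Ordinal ys) => //; rewrite ffunE /= nth_index.
Qed.

(** Union bound over the triples; for a fixed one, at least M - s independent permutations each
    respect the s inequalities with probability at most 1/(1+s). *)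
Lemma card_crushed M N s :
  s.+1 ^ (M - s) *
      #|[set p : {ffun 'I_M -> {perm 'I_N}} | crushed (fun y j => p y j) s]|
    <= N ^ (s + s) * M ^ s * N`! ^ M.
Proof.
set A := [set p | _].
pose I := ({ffun 'I_s -> 'I_N} * {ffun 'I_s -> 'I_N} * {ffun 'I_s -> 'I_M})%type.
pose P (t : I) (p : {ffun 'I_M -> {perm 'I_N}}) := crushing (fun y j => p y j) t.
apply: leq_trans (leq_mul (leqnn _) (card_set_exists P)) _.
rewrite big_distrr /=.
have -> : N ^ (s + s) * M ^ s * N`! ^ M = \sum_(t : I) N`! ^ M.
  by rewrite sum_nat_const !card_prod !card_ffun !card_ord expnD.
apply: leq_sum => -[[d e] h] _; rewrite /P.
have [/andP[/injectiveP d_inj /forallP ed]|bad] :=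
  boolP (injectiveb d && [forall i, forall k, e i != d k]); last first.
  rewrite (_ : [set x | _] = set0) ?cards0 ?muln0 //.
  by apply/setP => p; rewrite !inE /crushing andbA (negbTE bad).
pose E := [set u : {perm 'I_N} | [forall i, u (d i) < u (e i)]].
pose Y := ~: [set h i | i : 'I_s].
have kE : s.+1 * #|E| <= #|{perm 'I_N}|.
  rewrite card_Sn; apply: card_perm_ordered_pairs => // i k.
  exact: (forallP (ed i)).
have := card_ffun_in Y kE; rewrite card_Sn card_ord; apply: leq_trans.
apply: leq_mul.
  apply: leq_pexp2l => //.
  have : #|[set h i | i : 'I_s]| <= s.
    by rewrite (leq_trans (leq_imset_card _ _)) ?card_ord.
  by have := cardsC [set h i | i : 'I_s]; rewrite -/Y card_ord; lia.
apply: subset_leq_card; apply/subsetP => p; rewrite !inE => /and3P[_ _ /forall_inP pY].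
by apply/forall_inP => y yY; rewrite inE; apply: pY.
Qed.

(** * What solvability forces on the payoffs *)

Lemma elim_roundE m n (g : game m n) (S : subgame m n) :
  elim_round g S = (undominated (fun j i => row_payoff g i j) S.2 S.1,
                    undominated (col_payoff g) S.1 S.2).
Proof. by []. Qed.

(** A round that brings a player's losses to s or more crushes: its dominations hold on the
    opponent's set before the round, which still lacks fewer than s actions. Otherwise more than m -
    s >= 1 rows survive. *)
Lemma dominance_solvable_crushed m n (g : game m n) s :
    0 < s -> s < m -> s < n -> dominance_solvable g ->
  crushed (fun j i => row_payoff g i j) s || crushed (col_payoff g) s.
Proof.
move=> s0 sm sn; apply: contraTT; rewrite negb_or => /andP[Nrow Ncol].
pose inv (S : subgame m n) :=
  [/\ m < #|S.1| + s, n < #|S.2| + s,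
      covered (fun j i => row_payoff g i j) S.2 S.1
    & covered (col_payoff g) S.1 S.2].
suff : inv (surviving g).
  case=> m1 _ _ _; rewrite /dominance_solvable negb_and; apply/orP; left.
  by apply: contraTneq m1 => ->; lia.
rewrite /surviving; elim: (m + n)%N => [|k IHk].
  by split; rewrite /= ?cardsT ?card_ord //; try lia; move=> j; rewrite inE.
rewrite iterS; move: (iter k _ _) IHk => [Y X] [/= Ym Xn covY covX].
have Y0 : Y != set0 by apply: contraTneq Ym => ->; rewrite cards0; lia.
have X0 : X != set0 by apply: contraTneq Xn => ->; rewrite cards0; lia.
rewrite elim_roundE /=.
have subU (T1 T2 : finType) (v : T1 -> T2 -> nat) A (B : {set T2}) :
    undominated v A B \subset B.
  by apply/subsetP => j; rewrite inE => /andP[].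
have covY' := covered_undominated X0 covY.
have covX' := covered_undominated Y0 covX.
split=> /=.
- rewrite ltnNge; apply: contra Nrow => le.
  apply: covered_crushed covY'; rewrite ?card_ord // ; move: Xn le => /=; lia.
- rewrite ltnNge; apply: contra Ncol => le.
  apply: covered_crushed covX'; rewrite ?card_ord //; move: Ym le => /=; lia.
- by move=> j /covY'[j' j'U dj]; exists j' => //; apply: dominates_sub dj.
- by move=> j /covX'[j' j'U dj]; exists j' => //; apply: dominates_sub dj.
Qed.

Lemma card_game m n : #|game m n| = m`! ^ n * n`! ^ m.
Proof. by rewrite card_prod !card_ffun !card_Sn !card_ord. Qed.

(** While all rows remain, no column of [X] can fall; while [X] remains, a deleted row would be
    dominated on [X]. Without such a domination all m > 1 rows survive. *)
Lemma solvable_row_dominated m n (g : game m n) :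
    1 < m -> dominance_solvable g ->
  [exists i, exists i', dominates (fun j i => row_payoff g i j)
    (undominated (col_payoff g) [set: 'I_m] [set: 'I_n]) i i'].
Proof.
move=> m1; apply: contraTT => Ndom; set X := undominated _ _ _ in Ndom.
suff [full _] : (surviving g).1 = [set: 'I_m] /\ X \subset (surviving g).2.
  by rewrite /dominance_solvable full cardsT card_ord gtn_eqF.
rewrite /surviving; elim: (m + n)%N => [|k]; first by split; last exact: subsetT.
rewrite iterS elim_roundE; case: (iter k _ _) => Y Z /= [-> XZ]; split.
  apply/setP => i; rewrite !inE /=; apply: contra Ndom => /exists_inP[i' _ dom].
  by apply/existsP; exists i; apply/existsP; exists i'; apply: dominates_sub dom.
apply/subsetP => j jX; rewrite inE (subsetP XZ) //=.
move: jX; rewrite inE => /andP[_]; apply: contra => /exists_inP[j' _ dom].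
by apply/exists_inP; exists j'.
Qed.

Lemma card_solvable_crushed m n s :
    0 < s -> s < m -> m <= n ->
  s.+1 ^ (m - s) * #|[set g : game m n | dominance_solvable g]|
    <= 2 * n ^ (s + s + s) * #|game m n|.
Proof.
move=> s0 sm mn; rewrite card_game.
pose RP : finType := {ffun 'I_n -> {perm 'I_m}}.
pose CP : finType := {ffun 'I_m -> {perm 'I_n}}.
pose A := [set r : {ffun 'I_n -> {perm 'I_m}} | crushed (fun j i => r j i) s].
pose B := [set c : {ffun 'I_m -> {perm 'I_n}} | crushed (fun i j => c i j) s].
have sub : [set g : game m n | dominance_solvable g] \subset
    setX A [set: CP] :|: setX [set: RP] B.
  apply/subsetP => g; rewrite !inE andbT /= => sol.
  exact: dominance_solvable_crushed s0 sm (leq_trans sm mn) sol.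
apply: leq_trans (leq_mul (leqnn _) (subset_leq_card sub)) _.
apply: leq_trans (leq_mul (leqnn _) (leq_card_setU _ _)) _.
rewrite !cardsX !cardsT !card_ffun !card_Sn !card_ord mulnDr.
rewrite mul2n -addnn mulnDl leq_add //.
  rewrite mulnA mulnA leq_mul //.
  apply: leq_trans (_ : s.+1 ^ (n - s) * #|A| <= _).
    by rewrite leq_mul // leq_pexp2l // leq_sub2r.
  apply: leq_trans (card_crushed n m s) _.
  by rewrite leq_mul // [X in _ <= X]expnD leq_mul // leq_exp2r ?addn_gt0 ?s0.
rewrite mulnCA [X in _ <= X]mulnCA leq_mul2l; apply/orP; right.
apply: leq_trans (card_crushed m n s) _.
by rewrite leq_mul // [X in _ <= X]expnD leq_mul // leq_exp2r.
Qed.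

(** * Games with a dominant column *)

Lemma dominant_column_solvable m n (g : game m n) (j : 'I_n) :
    0 < m -> (forall i j', j' != j -> col_payoff g i j' < col_payoff g i j) ->
  dominance_solvable g.
Proof.
move=> m0 top.
have [S1 jS] : (surviving g).1 != set0 /\ j \in (surviving g).2.
  rewrite /surviving; elim: (m + n)%N => [|k].
    by split; rewrite ?inE // -card_gt0 cardsT card_ord.
  rewrite iterS elim_roundE; case: (iter k _ _) => Y X /= [Y0 jX].
  split; last first.
    rewrite inE jX; apply/negP => /exists_inP[j' _ /forall_inP dom].
    have [y yY] := set0Pn _ Y0; have := dom y yY.
    have [->|/top jj'] := eqVneq j' j; first by rewrite ltnn.
    by rewrite ltnNge ltnW.
  have [i iY] := set0Pn _ Y0; have X0 : X != set0 by apply/set0Pn; exists j.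
  set v := fun _ _ => _; apply/set0Pn.
  have [|/(undominated_dominator X0 iY)[i' i'U _]] :=
    boolP (i \in undominated v X Y); [by exists i|by exists i'].
rewrite /dominance_solvable; have := surviving_stable g; rewrite elim_roundE.
case: (surviving g) S1 jS => Y X Y0 jX [EY EX] /=; rewrite /= in Y0 jX EY EX.
have X1 : X = [set j].
  apply/eqP; rewrite eqEsubset sub1set jX andbT; apply/subsetP => j'.
  rewrite -{1}EX !inE => /andP[_]; apply: contraNT => /top jj'.
  by apply/exists_inP; exists j => //; apply/forall_inP.
rewrite X1 cards1 eqxx andbT eqn_leq card_gt0 Y0 andbT; apply/card_le1_eqP => i i'.
have dom k k' : k \in Y -> k' \in Y -> row_payoff g k' j <= row_payoff g k j.
  move=> kY k'Y; rewrite leqNgt; move: kY; rewrite -{1}EY inE => /andP[_].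
  apply: contra => lt; apply/exists_inP; exists k' => //.
  by apply/forall_inP => x; rewrite X1 inE => /eqP ->.
move=> iY i'Y; apply: (@perm_inj _ (g.1 j)); apply/val_inj/eqP.
by rewrite eqn_leq; apply/andP; split; apply: dom.
Qed.

(** [F] builds a game from the dominant column, each row's ranking of the other columns, and
    arbitrary payoffs for Row. *)
Lemma card_solvable_ge m n :
    0 < m -> 0 < n ->
  #|game m n| <= n ^ (m - 1) * #|[set g : game m n | dominance_solvable g]|.
Proof.
case: n => // n m0 _; rewrite card_game.
pose T : finType := (('I_n.+1 * {ffun 'I_m -> {perm 'I_n}})
  * {ffun 'I_n.+1 -> {perm 'I_m}})%type.
pose F (t : T) : game m n.+1 :=
  (t.2, [ffun y => lift_perm t.1.1 ord_max (t.1.2 y)]).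
have F_inj : injective F.
  move=> [[j c] r] [[j' c'] r'] [-> /ffunP E].
  have jj' : j = j'.
    have := E (Ordinal m0); rewrite !ffunE /=.
    move=> /(congr1 (fun u : {perm 'I_n.+1} => (u^-1)%g ord_max)).
    by rewrite !lift_permV !lift_perm_id.
  congr (_, _, _) => //; apply/ffunP => y; have := E y; rewrite !ffunE /= jj'.
  by move=> /(@lift_perm_inj2 _ j' (_, _) (_, _)) [].
have : #|F @: [set: T]| <= #|[set g : game m n.+1 | dominance_solvable g]|.
  apply: subset_leq_card; apply/subsetP => _ /imsetP[[[j c] r] _ ->]; rewrite inE.
  apply: (@dominant_column_solvable _ _ _ j) => // i j'; rewrite /col_payoff ffunE /=.
  case: (unliftP j j') => [k ->|->]; last by rewrite eqxx.
  by rewrite lift_perm_lift lift_perm_id lift_max ltn_ord.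
rewrite card_imset // cardsT !card_prod !card_ffun !card_Sn !card_ord => le.
apply: leq_trans (leq_mul (leqnn _) le).
rewrite factS expnMn -[in n.+1 ^ m](subnK m0) expnD expn1.
by apply: eq_leq; ring.
Qed.

(** * Records *)

(** Right-to-left maxima. *)
Definition records n (u : {perm 'I_n}) : {set 'I_n} :=
  [set i : 'I_n | [forall k : 'I_n, (i < k) ==> (u k < u i)]].

Lemma ltn_lift n (k : 'I_n.+1) (a b : 'I_n) : (lift k a < lift k b) = (a < b).
Proof. by rewrite /lift /= /bump; do 2!case: leqP => /=; lia. Qed.

Lemma card_set_recl n (A : {set 'I_n.+1}) :
  #|A| = (ord0 \in A) + #|[set i | lift ord0 i \in A]|.
Proof.
rewrite -sum1_card big_mkcond big_ord_recl -sum1dep_card [in RHS]big_mkcond.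
by congr (_ + _); case: (ord0 \in A).
Qed.

Lemma records_lift n (k : 'I_n.+1) (u : {perm 'I_n}) i :
  (lift ord0 i \in records (lift_perm ord0 k u)) = (i \in records u).
Proof.
rewrite !inE; apply/forallP/forallP => rec j.
  have := rec (lift ord0 j).
  by rewrite !lift_perm_lift !ltn_lift.
have [->|[j' ->]] : j = ord0 \/ exists j', j = lift ord0 j'.
- by case: (unliftP ord0 j) => [j' ->|->]; [right; exists j'|left].
- by [].
by rewrite !lift_perm_lift !ltn_lift.
Qed.

Lemma records_ord0 n (k : 'I_n.+1) (u : {perm 'I_n}) :
  (ord0 \in records (lift_perm ord0 k u)) = (k == ord_max).
Proof.
rewrite inE; apply/forallP/eqP => [rec|-> j].
  apply/val_inj/eqP; rewrite /= eqn_leq -ltnS ltn_ord leqNgt /=.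
  apply/negP => kn.
  have := rec (lift ord0 ((u^-1)%g (Ordinal kn))).
  rewrite lift0 ltn0Sn /= lift_perm_lift permKV lift_perm_id.
  by rewrite /lift /= /bump leqnn /=; lia.
case: (unliftP ord0 j) => [j' ->|->]; last by rewrite ltnn.
rewrite lift_perm_lift lift_perm_id; apply/implyP => _.
by rewrite lift_max /= ltn_ord.
Qed.

Lemma bigop_lift_perm (V : nmodType) n (F : {perm 'I_n.+1} -> V) :
  (\sum_u F u = \sum_(k < n.+1) \sum_u F (lift_perm ord0 k u))%R.
Proof.
rewrite pair_big (reindex (fun ku => lift_perm ord0 ku.1 ku.2)) //=.
apply: onW_bij; apply: inj_card_bij; first exact: lift_perm_inj2.
by rewrite card_prod !card_Sn card_ord factS.
Qed.

Lemma bigop_ffun_recl (V : nmodType) p (T : finType)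
    (F : T -> {ffun 'I_p -> T} -> V) :
  (\sum_(c : {ffun 'I_p.+1 -> T}) F (c ord0) [ffun i => c (lift ord0 i)]
     = \sum_t \sum_c F t c)%R.
Proof.
rewrite pair_big /= [RHS](reindex (fun c : {ffun 'I_p.+1 -> T} =>
  (c ord0, [ffun i => c (lift ord0 i)]))) //=.
apply: onW_bij; exists (fun tc : T * {ffun 'I_p -> T} =>
  [ffun i => if unlift ord0 i is Some j then tc.2 j else tc.1]).
  move=> c; apply/ffunP => i; rewrite ffunE /=.
  by case: unliftP => [j ->|->]; rewrite ?ffunE.
move=> [t c] /=; rewrite ffunE unlift_none; congr (_, _).
by apply/ffunP => i; rewrite !ffunE liftK.
Qed.

(* The actions [j] that survive the comparison of two rows [s] and [t]; for   *)
(* t = s * u, these are the records of [u] read in the order given by [s].    *)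
Definition pareto n (s t : {perm 'I_n}) : {set 'I_n} :=
  [set j | ~~ [exists j', (s j < s j') && (t j < t j')]].

Definition pareto_union n p (s : {perm 'I_n}) (U : {set 'I_n})
    (c : {ffun 'I_p -> {perm 'I_n}}) :=
  U :|: \bigcup_(y < p) pareto s (c y).

Lemma pareto_records n (s u : {perm 'I_n}) (U : {set 'I_n}) :
  #|pareto s (s * u)%g :\: U| = #|records u :\: (s @: U)|.
Proof.
rewrite -(card_imset (pareto s (s * u)%g :\: U) (@perm_inj _ s)).
apply: eq_card => j; rewrite -[j](permKV s) (mem_imset _ _ (@perm_inj _ s)).
rewrite !inE (mem_imset _ _ (@perm_inj _ s)); congr (_ && _).
rewrite negb_exists; set i := (s^-1)%g j.
apply/forallP/forallP => rec k.
  have := rec ((s^-1)%g k); rewrite !permM permKV negb_and -implybE.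
  move=> /implyP ik; apply/implyP => lt; have := ik lt.
  rewrite -leqNgt leq_eqVlt => /orP[/eqP/val_inj/perm_inj E|//].
  by rewrite E ltnn in lt.
rewrite negb_and -implybE; apply/implyP => lt; rewrite !permM -leqNgt ltnW //.
by have := rec (s k); rewrite lt.
Qed.

Lemma card_set_pair (T1 T2 : finType) (P : pred (T1 * T2)) :
  #|[set x | P x]| = \sum_y #|[set x | P (x, y)]|.
Proof.
under eq_bigr do rewrite -sum1dep_card big_mkcond.
rewrite exchange_big pair_big -sum1dep_card big_mkcond.
by apply: eq_bigr => -[].
Qed.

(* For i = i' the set is empty unless X is.                                   *)
Lemma card_row_dominated m n (X : {set 'I_n}) (i i' : 'I_m) :
  2 ^ #|X| * #|[set r : {ffun 'I_n -> {perm 'I_m}} |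
       dominates (fun j i => r j i) X i i']| <= m`! ^ n.
Proof.
pose E := [set u : {perm 'I_m} | u i < u i'].
have E2 : 2 * #|E| <= #|{perm 'I_m}|.
  have [ii'|ii'] := eqVneq i i'.
    rewrite (_ : E = set0) ?cards0 //; apply/setP => u.
    by rewrite !inE ii' ltnn.
  rewrite card_Sn.
  have dinj : injective (fun _ : 'I_1 => i) by move=> x y _; rewrite !ord1.
  have ne : 'I_1 -> 'I_1 -> i' != i by rewrite eq_sym.
  apply: leq_trans (card_perm_ordered_pairs dinj ne).
  rewrite leq_mul2l; apply/orP; right; apply: subset_leq_card.
  by apply/subsetP => u; rewrite !inE => ui; apply/forallP.
have := card_ffun_in X E2; rewrite card_Sn card_ord; apply: leq_trans.
rewrite leq_mul2l; apply/orP; right; apply: subset_leq_card.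
apply/subsetP => r; rewrite !inE => /forall_inP rX; apply/forall_inP => x xX.
by rewrite inE; apply: rX.
Qed.

(** A dominator beats its column in row 0 and in each other row at once, so a dominated column lies
    in no [pareto] set. *)
Lemma pareto_undominated m n (g : game m.+1 n) :
  pareto_union (g.2 ord0) set0 [ffun y : 'I_m => g.2 (lift ord0 y)]
    \subset undominated (col_payoff g) [set: 'I_m.+1] [set: 'I_n].
Proof.
rewrite /pareto_union set0U; apply/bigcupsP => y _; apply/subsetP => j.
rewrite !inE /=; apply: contra => /exists_inP[j' _ /forall_inP dom].
by apply/existsP; exists j'; rewrite ffunE !dom ?inE.
Qed.

Local Open Scope ring_scope.

(** Position i is a record with probability 1/(n-i), independently, so the mean is the product of 1
    - 1/(2(n-i)) over i outside [U]. Squaring avoids roots; the induction peels off position 0. *)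
Lemma sum_records_le (R : realFieldType) n (U : {set 'I_n}) :
  (\sum_u 2^-1 ^+ #|records u :\: U|) ^+ 2 * n.+1%:R
    <= n`!%:R ^+ 2 * #|U|.+1%:R :> R.
Proof.
elim: n U => [|n IHn] U.
  rewrite (eq_bigr (fun=> 1)) => [|u _].
    by rewrite sumr_const card_Sn !expr1n !mul1r ler_nat.
  by rewrite (_ : _ :\: _ = finset.set0) ?cards0 //; apply/setP => -[].
set U' := [set i | lift ord0 i \in U].
have split_w k u : 2^-1 ^+ #|records (lift_perm ord0 k u) :\: U| =
    2^-1 ^+ ((ord0 \notin U) && (k == ord_max)) * 2^-1 ^+ #|records u :\: U'| :> R.
  rewrite card_set_recl in_setD records_ord0 exprD; congr (_ * _ ^+ _).
  by apply: eq_card => i; rewrite in_set !in_setD records_lift [i \in U']in_set.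
rewrite bigop_lift_perm.
under eq_bigr => k _ do
  (under eq_bigr => u _ do rewrite split_w; rewrite -big_distrr /=).
rewrite -big_distrl /= big_ord_recr /=.
have -> : \sum_(i < n) 2^-1 ^+ ((ord0 \notin U) &&
    (widen_ord (leqnSn n) i == ord_max)) = n%:R :> R.
  rewrite (eq_bigr (fun=> 1)) ?sumr_const ?card_ord // => i _.
  by rewrite -val_eqE /= ltn_eqF ?andbF.
rewrite eqxx andbT.
have := IHn U'; set a := \sum_u _; rewrite (card_set_recl U) -/U' => le.
have leU : (#|U'|%:R : R) <= n%:R by rewrite ler_nat -[X in (_ <= X)%N]card_ord max_card.
have n0 : (0 : R) <= n%:R by [].
rewrite factS natrM -!natr1 ?natrD; move: le leU.
rewrite -!natr1; set x := (n%:R : R) in n0 *; set f := n`!%:R; set w := #|U'|%:R.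
move=> le leU.
have w0 : 0 <= w by rewrite /w.
have f0 : 0 <= f ^+ 2 by apply: sqr_ge0.
have goal (z y : R) : 0 <= z -> z * (w + 1) <= (x + 1) * y ->
    (a ^+ 2 * (x + 1) <= f ^+ 2 * (w + 1)) -> a ^+ 2 * z <= f ^+ 2 * y.
  move=> z0 zy h.
  have x1 : 0 < x + 1 by rewrite ltr_wpDl.
  rewrite -(ler_pM2r x1).
  have := ler_wpM2r z0 h; move=> h1.
  have := ler_wpM2l f0 zy; lra.
have [U0|U0] /= := boolP (ord0 \in U).
  have H : (x + 2) * (w + 1) <= (x + 1) * (w + 2) by lra.
  have x2 : 0 <= x + 2 by lra.
  have x12 : 0 <= (x + 1) ^+ 2 by apply: sqr_ge0.
  have := ler_wpM2l x12 (goal _ _ x2 H le); rewrite expr0; lra.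
(* Here position 0 is outside [U] and contributes n + 1/2: its top value has weight 1/2, the n
   others weight 1. *)
have H : (x + 2^-1) ^+ 2 * (x + 2) * (w + 1) <= (x + 1) * ((x + 1) ^+ 2 * (w + 1)).
  have w1 : 0 <= w + 1 by lra.
  have : (x + 2^-1) ^+ 2 * (x + 2) <= (x + 1) ^+ 3 by nra.
  by move=> /(ler_wpM2r w1); lra.
have z0 : 0 <= (x + 2^-1) ^+ 2 * (x + 2) by rewrite mulr_ge0 ?sqr_ge0 //; lra.
have -> : 0 + 1 + 1 = 2 :> R by lra.
by have := goal _ _ z0 H le; rewrite expr1; lra.
Qed.

Lemma sum_pareto_le (R : realFieldType) n (s : {perm 'I_n}) (U : {set 'I_n})
    B (q : R) :
    0 <= q -> B.+1%:R <= q ^+ 2 * n.+1%:R -> (#|U| <= B)%N ->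
  \sum_t 2^-1 ^+ #|pareto s t :\: U| <= n`!%:R * q.
Proof.
move=> q0 qB UB; rewrite (reindex_inj (mulgI s)) /=.
under eq_bigr do rewrite pareto_records.
have sum0 (V : {set 'I_n}) : 0 <= \sum_u 2^-1 ^+ #|records u :\: V| :> R.
  by apply: sumr_ge0 => u _; rewrite exprn_ge0 ?invr_ge0.
rewrite -(ler_sqr (x := \sum_u _)) ?nnegrE ?mulr_ge0 //.
rewrite -(ler_pM2r (x := n.+1%:R)) ?ltr0n //.
apply: le_trans (sum_records_le R _) _.
rewrite card_imset; last exact: perm_inj.
rewrite [X in _ <= X * _]exprMn -[X in _ <= X]mulrA ler_wpM2l ?sqr_ge0 //.
by apply: le_trans qB; rewrite ler_nat.
Qed.

(** While [U] has at most [B] columns, a new row gains a factor [q]; once it has more, the weight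
    stays below 2^-B. *)
Lemma sum_pareto_union_le (R : realFieldType) n p (s : {perm 'I_n})
    (U : {set 'I_n}) B (q : R) :
    0 <= q -> B.+1%:R <= q ^+ 2 * n.+1%:R ->
  \sum_(c : {ffun 'I_p -> {perm 'I_n}}) 2^-1 ^+ #|pareto_union s U c|
    <= n`!%:R ^+ p * (2^-1 ^+ B + q ^+ p * 2^-1 ^+ #|U|).
Proof.
move=> q0 qB; elim: p U => [|p IHp] U.
  rewrite (eq_bigr (fun=> 2^-1 ^+ #|U|)) => [|c _]; last first.
    by rewrite /pareto_union big_ord0 finset.setU0.
  rewrite sumr_const card_ffun card_ord expn0 mulr1n !expr0 !mul1r lerDr.
  by rewrite exprn_ge0 ?invr_ge0.
have [UB|BU] := leqP #|U| B; last first.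
  apply: le_trans (_ : \sum_(c : {ffun 'I_p.+1 -> {perm 'I_n}}) 2^-1 ^+ B <= _).
    apply: ler_sum => c _; rewrite ler_wiXn2l ?invr_ge0 ?invf_le1 ?ler1n //.
    by rewrite (leq_trans (ltnW BU)) // subset_leq_card // finset.subsetUl.
  rewrite sumr_const card_ffun card_ord card_Sn -[_ *+ _]mulr_natl natrX.
  by rewrite ler_wpM2l ?exprn_ge0 // lerDl mulr_ge0 ?exprn_ge0 ?invr_ge0.
pose F t (c : {ffun 'I_p -> {perm 'I_n}}) : R :=
  2^-1 ^+ #|pareto_union s (U :|: pareto s t) c|.
have -> : \sum_(c : {ffun 'I_p.+1 -> {perm 'I_n}}) 2^-1 ^+ #|pareto_union s U c|
    = \sum_t \sum_c F t c.
  rewrite -bigop_ffun_recl; apply: eq_bigr => c _; congr (_ ^+ #|pred_of_set _|).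
  rewrite /pareto_union big_ord_recl finset.setUA; congr (_ :|: _).
  by apply: eq_bigr => i _; rewrite ffunE.
apply: le_trans (ler_sum _ (fun t _ => IHp (U :|: pareto s t))) _.
rewrite -big_distrr exprSr -mulrA ler_wpM2l ?exprn_ge0 //=.
rewrite big_split /= sumr_const card_Sn -[_ *+ n`!]mulr_natl mulrDr lerD2l.
rewrite -big_distrr exprSr /= mulrCA -mulrA ler_wpM2l ?exprn_ge0 //.
under eq_bigr => t _.
  rewrite -(finset.cardsID U) finset.setUK finset.setDUl.
  rewrite finset.setDv finset.set0U exprD.
  over.
rewrite -big_distrr /= mulrA [X in _ <= X]mulrC.
by rewrite ler_wpM2l ?exprn_ge0 ?invr_ge0 // [X in _ <= X]mulrC
  (sum_pareto_le s q0 qB UB).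
Qed.

(** Given Column's payoffs, each pair of rows is in domination on [X c] with probability at most
    2^-|X c|; then average over [c]. *)
Lemma solvable_le_pareto (R : realFieldType) m n B (q : R) :
    (0 < m)%N -> 0 <= q -> B.+1%:R <= q ^+ 2 * n.+1%:R ->
  #|[set g : game m.+1 n | dominance_solvable g]%SET|%:R / #|game m.+1 n|%:R
    <= m.+1%:R ^+ 2 * (2^-1 ^+ B + q ^+ m).
Proof.
move=> m0 q0 qB; rewrite ler_pdivrMr ?ltr0n; last first.
  by rewrite card_game muln_gt0 !expn_gt0 !fact_gt0.
pose RP : finType := {ffun 'I_n -> {perm 'I_m.+1}}.
pose CP : finType := {ffun 'I_m.+1 -> {perm 'I_n}}.
pose X (c : {ffun 'I_m.+1 -> {perm 'I_n}}) :=
  undominated (fun i j => c i j) [set: 'I_m.+1]%SET [set: 'I_n]%SET.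
have half0 k : 0 <= 2^-1 ^+ k :> R by rewrite exprn_ge0 ?invr_ge0.
have count c : (#|[set r : RP | dominance_solvable ((r, c) : game m.+1 n)]%SET|%:R : R)
    <= m.+1%:R ^+ 2 * (m.+1`! ^ n)%:R * 2^-1 ^+ #|X c|.
  rewrite exprVn ler_pdivlMr ?exprn_gt0 // -!natrX -!natrM ler_nat mulnC.
  pose P (t : 'I_m.+1 * 'I_m.+1) (r : {ffun 'I_n -> {perm 'I_m.+1}}) :=
    dominates (fun j i => r j i) (X c) t.1 t.2.
  have sub : ([set r : RP | dominance_solvable ((r, c) : game m.+1 n)] \subset
      [set r | [exists t, P t r]])%SET.
    apply/fintype.subsetP => r; rewrite !inE => /(@solvable_row_dominated _ _ (r, c)).
    move=> /(_ m0) /existsP[i /existsP[i' dom]].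
    by apply/existsP; exists (i, i').
  apply: leq_trans (leq_mul (leqnn _) (subset_leq_card sub)) _.
  apply: leq_trans (leq_mul (leqnn _) (card_set_exists P)) _.
  rewrite big_distrr /= expnS expn1.
  have -> : (m.+1 * m.+1 * m.+1`! ^ n = \sum_(t : 'I_m.+1 * 'I_m.+1) m.+1`! ^ n)%N.
    by rewrite sum_nat_const card_prod card_ord.
  by apply: leq_sum => t _; apply: card_row_dominated.
rewrite card_set_pair natr_sum; apply: le_trans (ler_sum _ (fun c _ => count c)) _.
rewrite -big_distrr /= card_game natrM -!mulrA !ler_wpM2l //.
rewrite [X in _ <= X]mulrCA ler_wpM2l //.
pose F (s : {perm 'I_n}) (c : {ffun 'I_m -> {perm 'I_n}}) : R :=
  2^-1 ^+ #|pareto_union s finset.set0 c|.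
apply: (@le_trans _ _ (\sum_(c : CP) F (c ord0) [ffun y => c (lift ord0 y)])).
  apply: ler_sum => c _; rewrite /F ler_wiXn2l ?invr_ge0 ?invf_le1 ?ler1n //.
  (* Row's payoffs are a dummy here: [X c] depends on [c] only. *)
  exact/subset_leq_card/(@pareto_undominated m n ([ffun=> 1%g], c)).
rewrite bigop_ffun_recl.
apply: le_trans (ler_sum _ (fun s _ => sum_pareto_union_le m s finset.set0 q0 qB)) _.
rewrite sumr_const card_Sn cards0 expr0 mulr1 -[X in X <= _]mulr_natl mulrA.
by rewrite expnS natrM natrX mulrC.
Qed.

(** * The probability bounds *)

From mathcomp Require Import all_classical all_reals all_analysis.
Import numFieldNormedType.Exports.
Local Open Scope classical_set_scope.
Local Open Scope ring_scope.

Lemma card_game_gt0 m n : (0 < #|game m n|)%N.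
Proof. by rewrite card_game muln_gt0 !expn_gt0 !fact_gt0. Qed.

Lemma solvability_prob_ge0 (R : realType) m n : 0 <= solvability_prob R m n.
Proof. exact: divr_ge0. Qed.

Lemma solvability_prob_le1 (R : realType) m n : solvability_prob R m n <= 1.
Proof.
by rewrite ler_pdivrMr ?ltr0n ?card_game_gt0 // mul1r ler_nat max_card.
Qed.

Lemma solvability_prob_ge (R : realType) m n :
  (0 < m)%N -> (0 < n)%N -> n%:R ^- (m - 1) <= solvability_prob R m n.
Proof.
move=> m0 n0; rewrite ler_pdivlMr ?ltr0n ?card_game_gt0 // mulrC.
rewrite ler_pdivrMr ?exprn_gt0 ?ltr0n // mulrC -natrX -natrM ler_nat.
exact: card_solvable_ge.
Qed.

Lemma solvability_prob_crushed (R : realType) m n s :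
    (0 < s)%N -> (s < m)%N -> (m <= n)%N ->
  solvability_prob R m n * s.+1%:R ^+ (m - s) <= 2 * n%:R ^+ (s + s + s).
Proof.
move=> s0 sm mn; rewrite /solvability_prob mulrAC.
rewrite ler_pdivrMr ?ltr0n ?card_game_gt0 // mulrC.
by rewrite -!natrX -!natrM ler_nat card_solvable_crushed.
Qed.

Lemma exprn_ge32 (R : realFieldType) (x : R) k :
  4 <= x -> (3 <= k)%N -> 32 <= x ^+ k.
Proof.
move=> x4 k3; apply: le_trans (_ : 4 ^+ 3 <= _); first lra.
apply: (@le_trans _ _ (x ^+ 3)); first by rewrite lerXn2r ?nnegrE //; lra.
by rewrite ler_weXn2l //; lra.
Qed.

(* From here on x stands for n^(1/256), which turns the powers of n with      *)
(* rational exponents into natural powers.                                    *)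
Lemma crushed_exponents (R : realType) m n (x : R) a :
    4 <= x -> x ^+ 256 = n%:R -> (32 <= m)%N -> (m <= n)%N ->
    x ^+ a <= (m %/ 32).+1%:R ->
  solvability_prob R m n * x ^+ (a * (m - m %/ 32))
    <= 2 * x ^+ (768 * (m %/ 32)).
Proof.
move=> x4 xn m32 mn xs; set s := (m %/ 32)%N in xs *.
have s0 : (0 < s)%N by rewrite divn_gt0.
have sm : (s < m)%N by rewrite ltn_Pdiv //; lia.
have x0 : 0 <= x by lra.
have -> : (768 * s = 256 * (s + s + s))%N by lia.
rewrite [in X in _ <= X]exprM xn; apply: le_trans (solvability_prob_crushed R s0 sm mn).
by rewrite ler_wpM2l ?solvability_prob_ge0 // exprM lerXn2r ?nnegrE ?exprn_ge0.
Qed.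

(** Here s + 1 >= m/32 >= x^32, and 32(m - s) - 768s >= 7m because 800s <= 25m. *)
Lemma solvability_prob_large (R : realType) m n (x : R) :
    4 <= x -> x ^+ 256 = n%:R -> (m <= n)%N -> (n < m ^ 4)%N ->
  solvability_prob R m n * x ^+ m <= 2.
Proof.
move=> x4 xn mn nm.
have x1 : 1 <= x by lra.
have x0 : 0 <= x by lra.
have x64 : x ^+ 64 < m%:R.
  rewrite -(@ltr_pXn2r _ 4) ?nnegrE ?exprn_ge0 // -exprM xn.
  by rewrite -natrX ltr_nat.
have x32 : 32 <= x ^+ 32 by apply: exprn_ge32.
have m32 : (32 <= m)%N.
  rewrite -(ler_nat R) (le_trans x32) // (le_trans _ (ltW x64)) //.
  by rewrite ler_weXn2l.
have := @crushed_exponents R m n x 32 x4 xn m32 mn.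
set s := (m %/ 32)%N; set p := solvability_prob R m n => H.
have {}H : p * x ^+ (32 * (m - s)) <= 2 * x ^+ (768 * s).
  apply: H; rewrite -(@ler_pM2l _ 32) //.
  apply: le_trans (_ : m%:R <= _).
    rewrite (le_trans _ (ltW x64)) // -[64%N]/(32 + 32)%N exprD ler_wpM2r //.
    exact: exprn_ge0.
  by rewrite -natrM ler_nat /s; lia.
have xs : 0 < x ^+ (768 * s) by rewrite exprn_gt0 //; lra.
rewrite -(ler_pM2r xs); apply: le_trans H.
rewrite -mulrA -exprD ler_wpM2l ?solvability_prob_ge0 //.
by rewrite ler_weXn2l // /s; lia.
Qed.

(** Now s + 1 >= n/32 >= x^128, and 128(n - s) - 768s >= 100n. Of the surplus over 86n, one power of
    x absorbs the factor 2. *)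
Lemma solvability_prob_square (R : realType) n (x : R) :
  4 <= x -> x ^+ 256 = n%:R -> solvability_prob R n n * x ^+ (86 * n) <= 1.
Proof.
move=> x4 xn.
have x1 : 1 <= x by lra.
have x0 : 0 <= x by lra.
have x32 : 32 <= x ^+ 128 by apply: exprn_ge32.
have nx : n%:R = x ^+ 128 * x ^+ 128 by rewrite -exprD -xn.
have n32 : (32 <= n)%N.
  rewrite -(ler_nat R) nx (le_trans x32) // ler_peMl ?exprn_ge0 //.
  exact: exprn_ege1.
have := @crushed_exponents R n n x 128 x4 xn n32 (leqnn n).
set s := (n %/ 32)%N; set p := solvability_prob R n n => H.
have {}H : p * x ^+ (128 * (n - s)) <= 2 * x ^+ (768 * s).
  apply: H; rewrite -(@ler_pM2l _ 32) //.
  apply: le_trans (_ : n%:R <= _).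
    by rewrite nx ler_wpM2r ?exprn_ge0.
  by rewrite -natrM ler_nat /s; lia.
have xs : 0 < x ^+ (768 * s + 1) by rewrite exprn_gt0 //; lra.
rewrite -(ler_pM2r xs) mul1r exprD expr1.
apply: le_trans (_ : 2 * x ^+ (768 * s) <= _); last first.
  by rewrite mulrC ler_wpM2l ?exprn_ge0 //; lra.
apply: le_trans H; rewrite -mulrA -exprSr -exprD ler_wpM2l ?solvability_prob_ge0 //.
by rewrite ler_weXn2l // /s; lia.
Qed.

(** With B = 2mk, k > x and q = x^-64, both 2^-B and q^(m-1) are at most x^(-2m), while m^2 <= 4^m
    <= x^m. *)
Lemma solvability_prob_small (R : realType) m n (x : R) :
    4 <= x -> x ^+ 256 = n%:R -> (1 < m)%N -> (m ^ 4 <= n)%N ->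
  solvability_prob R m n * x ^+ m <= 2.
Proof.
move=> x4 xn m1 mn.
have x1 : 1 <= x by lra.
have x0 : 0 < x by lra.
have x64 : m%:R <= x ^+ 64.
  rewrite -(@ler_pXn2r _ 4) ?nnegrE ?exprn_ge0 ?(ltW x0) // -exprM xn.
  by rewrite -natrX ler_nat.
pose k := (Num.truncn x).+1.
have /andP[kx xk] := truncn_itv (ltW x0).
pose B := (k * (2 * m))%N; pose q := x ^- 64.
have qB : B.+1%:R <= q ^+ 2 * n.+1%:R.
  have kx1 : k%:R <= x + 1 by rewrite -natr1; lra.
  have m0 : 0 <= m%:R :> R by [].
  have Bx : B%:R <= 4 * x * x ^+ 64.
    rewrite /B !natrM; apply: le_trans (_ : (2 * x) * (2 * x ^+ 64) <= _).
      by apply: ler_pM => //; [lra|rewrite ler_wpM2l].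
    lra.
  have x62 : 4 * x * x ^+ 64 + 1 <= x ^+ 128.
    have h63 : 32 <= x ^+ 63 by apply: exprn_ge32.
    have h65 : 1 <= x ^+ 65 by apply: exprn_ege1.
    rewrite -mulrA -exprS -[128%N]/(63 + 65)%N exprD.
    have : 32 * x ^+ 65 <= x ^+ 63 * x ^+ 65 by rewrite ler_wpM2r ?exprn_ge0 ?(ltW x0).
    lra.
  rewrite /q exprVn -exprM mulrC ler_pdivlMr ?exprn_gt0 // -!natr1.
  apply: le_trans (_ : x ^+ 128 * x ^+ 128 <= _).
    by rewrite ler_wpM2r ?exprn_ge0 ?(ltW x0) //; lra.
  by rewrite -exprD xn; lra.
have q0 : 0 <= q by rewrite /q invr_ge0 exprn_ge0 // ltW.
case: m m1 mn x64 @B qB => // m; rewrite ltnS => m0 mn x64 B qB.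
have := solvable_le_pareto (m := m) m0 q0 qB.
rewrite -/(solvability_prob R m.+1 n) => /(ler_wpM2r (exprn_ge0 m.+1 (ltW x0))).
move=> le; apply: le_trans le _.
have xm0 : 0 < x ^+ (2 * m.+1) by rewrite exprn_gt0.
have hB : 2^-1 ^+ B <= (x ^+ (2 * m.+1))^-1.
  rewrite /B exprM -[X in _ <= X]exprVn.
  rewrite lerXn2r ?nnegrE ?exprn_ge0 ?invr_ge0 ?(ltW x0) // exprVn.
  rewrite lef_pV2 ?posrE ?exprn_gt0 // (le_trans (ltW xk)) //.
  by rewrite -natrX ler_nat ltnW // ltn_expl.
have hq : q ^+ m <= (x ^+ (2 * m.+1))^-1.
  rewrite /q exprVn -exprM lef_pV2 ?posrE ?exprn_gt0 //.
  by rewrite ler_weXn2l //; lia.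
have hm : m.+1%:R ^+ 2 <= x ^+ m.+1.
  apply: le_trans (_ : 4 ^+ m.+1 <= _); last by rewrite lerXn2r ?nnegrE ?(ltW x0).
  rewrite -!natrX ler_nat -[4%N]/(2 ^ 2)%N -expnM mulnC expnM leq_exp2r //.
  by rewrite ltnW // ltn_expl.
apply: le_trans (_ : x ^+ m.+1 * (2 * (x ^+ (2 * m.+1))^-1) * x ^+ m.+1 <= _).
  rewrite ler_wpM2r ?exprn_ge0 ?(ltW x0) //.
  apply: ler_pM => //; last lra.
  by apply: addr_ge0; [rewrite exprn_ge0 ?invr_ge0|exact: exprn_ge0].
have : x ^+ m.+1 != 0 by rewrite expf_neq0 // gt_eqF.
rewrite mul2n -addnn exprD; set y := x ^+ m.+1 => y0.
by rewrite le_eqVlt; apply/orP; left; apply/eqP; field.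
Qed.

Lemma solvability_prob_exprn (R : realType) m n (x : R) :
    4 <= x -> x ^+ 256 = n%:R -> (1 < m)%N -> (m <= n)%N ->
  solvability_prob R m n * x ^+ m <= 2.
Proof.
move=> x4 xn m1 mn; have [|] := leqP (m ^ 4) n.
  exact: solvability_prob_small.
exact: solvability_prob_large.
Qed.

Lemma powR_root (R : realType) k n :
  (0 < k)%N -> (n%:R `^ k%:R^-1) ^+ k = n%:R :> R.
Proof.
move=> k0; rewrite -powR_mulrn ?powR_ge0 // -powRrM mulVf ?pnatr_eq0 -?lt0n //.
by rewrite powRr1.
Qed.

(** The upper bound asks for 1 < m: when m = 1 the lower bound makes the probability 1, while
    n^(-C2) tends to 0. *)
Theorem theorem1 (R : realType) :
  (exists C1 C2 : R, 0 < C1 /\ 0 < C2 /\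
     forall m n : nat, (0 < m)%N -> (m <= n)%N ->
       n%:R ^- (m - 1) <= solvability_prob R m n /\
       ((1 < m)%N ->
          solvability_prob R m n <= C1 * n%:R `^ (- (C2 * m%:R)))) /\
  (exists eps : nat -> R, (eps n @[n --> \oo] --> (0 : R)) /\
     forall n : nat, (0 < n)%N ->
       solvability_prob R n n <= n%:R `^ (- ((3^-1 - eps n) * n%:R))).
Proof.
pose x (n : nat) : R := n%:R `^ 256%:R^-1.
have xE n : x n ^+ 256 = n%:R by exact: powR_root.
have [N NP] : exists N : nat, forall n, (N <= n)%N -> 4 <= x n.
  have pow0 : 0 <= 4 ^+ 256 :> R by exact: exprn_ge0.
  have /andP[_ lt] := truncn_itv pow0.
  exists (Num.truncn (4 ^+ 256 : R)).+1 => n Nn.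
  rewrite -(@ler_pXn2r _ 256) ?nnegrE ?powR_ge0 // xE.
  by rewrite (le_trans (ltW lt)) // ler_nat.
split.
  (* The 2 serves x >= 4; if x < 4 then n < N, and x^m <= 4^m <= 4^N. *)
  exists (2 + 4 ^+ N), (256%:R^-1); split; first by rewrite ltr_wpDr ?exprn_ge0.
  split; first by rewrite invr_gt0.
  move=> m n m0 mn; have n0 : (0 < n)%N by apply: leq_trans mn.
  split; first exact: solvability_prob_ge.
  move=> m1; have xn0 : 0 < x n by rewrite powR_gt0 ?ltr0n.
  rewrite powRN powRrM powR_mulrn ?powR_ge0 // ler_pdivlMr ?exprn_gt0 //.
  have N0 : 0 <= 4 ^+ N :> R by exact: exprn_ge0.
  have [Nn|nN] := leqP N n.
    by have := solvability_prob_exprn (NP n Nn) (xE n) m1 mn; lra.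
  have [x4|/ltW x4] := leP 4 (x n).
    by have := solvability_prob_exprn x4 (xE n) m1 mn; lra.
  apply: le_trans (_ : 1 * 4 ^+ N <= _); last lra.
  apply: ler_pM; rewrite ?solvability_prob_ge0 ?solvability_prob_le1 //.
  apply: le_trans (_ : 4 ^+ m <= _).
    by rewrite lerXn2r ?nnegrE ?(ltW xn0).
  by rewrite ler_weXn2l ?ler1n //; lia.
exists (fun n => if (N <= n)%N then 0 else 3^-1); split.
  apply: cvg_near_cst; near=> n.
  by rewrite ifT //; near: n; exact: nbhs_infty_ge.
move=> n n0; case: ifP => [Nn|_]; last first.
  by rewrite subrr mul0r oppr0 powRr0 solvability_prob_le1.
have x4 := NP n Nn; have x0 : 0 < x n by lra.
apply: le_trans (_ : x n ^- (86 * n) <= _).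
  by rewrite -[_^-1]mul1r ler_pdivlMr ?exprn_gt0 // solvability_prob_square.
have -> r : n%:R `^ r = x n `^ (256%:R * r).
  by rewrite powRrM powR_mulrn ?powR_ge0 // xE.
rewrite -powR_mulrn ?powR_ge0 // -powRN.
apply: ler_powR; first lra.
rewrite natrM; have : 0 < n%:R :> R by rewrite ltr0n.
lra.
Unshelve. all: by end_near.
Qed.
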